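(* Let $I$ be a compact interval and $f:I\to I$ a continuous map. (i) $(I,f)$ is sensitive if and only if $(\mathcal{M}(I),\hat f)$ is sensitive. (ii) $(I,f)$ is syndetically sensitive if and only if $(\mathcal{M}(I),\hat f)$ is syndetically sensitive. (iii) $(I,f)$ is ergodically sensitive if and only if $(\mathcal{M}(I),\hat f)$ is ergodically sensitive.
   Context: For a compact metric space $(X,d)$, $\mathcal{M}(X)$ is the space of all Borel probability measures on $X$ with the Prohorov metric $\mathcal{P}_d(\mu,\nu)=\inf\{\epsilon>0:\mu(A)\le\nu(A^\epsilon)+\epsilon \text{ and } \nu(A)\le\mu(A^\epsilon)+\epsilon \text{ for all Borel } A\subset X\}$, where $A^\epsilon=\{x\in X: d(x,A)<\epsilon\}$; its topology is the weak$^*$-topology and $\mathcal{M}(X)$ is a compact metric space. For continuous $f:X\to X$ the induced continuous map is $\hat f(\mu)(A)=\mu(f^{-1}(A))$. For $x\in X$ and $\epsilon,\delta>0$ let $N_d(x,\epsilon,\delta)=\{n\ge1:\text{there exists } y \text{ with } d(x,y)<\epsilon \text{ and } d(f^n(x),f^n(y))>\delta\}$. A set $A=\{n_k\}_{k=1}^\infty$ of nonnegative integers (listed increasingly) is syndetic if there is $l\ge1$ with $n_{k+1}-n_k\le l$ for all $k\ge1$; a set $A$ of nonnegative integers is ergodic if $\limsup_{n\to\infty}|A\cap\{0,1,\dots,n-1\}|/n>0$. $(X,f)$ is sensitive (resp. syndetically sensitive, ergodically sensitive) if there is $\delta>0$ such that for all $x\in X$ and $\epsilon>0$ the set $N_d(x,\epsilon,\delta)$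 is nonempty (resp. syndetic, ergodic). For $\mathcal{M}(X)$ the metric used is $\mathcal{P}_d$. *)

(* Defs.v *)
From HB Require Import structures.
From mathcomp Require Import all_boot all_order all_algebra finmap.
From mathcomp Require Import all_classical all_reals all_analysis.

Set Implicit Arguments.
Unset Strict Implicit.
Unset Printing Implicit Defensive.

Import Order.TTheory GRing.Theory Num.Theory.
Import numFieldNormedType.Exports.

Local Open Scope classical_set_scope.
Local Open Scope ring_scope.

(* The increasing enumeration is infinite, so a syndetic set is infinite. *)
Definition syndetic (A : set nat) : Prop :=
  exists2 n_ : nat -> nat, {homo n_ : i j / (i < j)%N} & A = range n_ /\
    exists2 l : nat, (0 < l)%N & forall k, (n_ k.+1 - n_ k <= l)%N.

Definition ergodic (R : realType) (A : set nat) : Prop :=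
  (0 < limn_esup (fun n => (#|` fset_set (A `&` `I_n)|%:R / n%:R : R)%:E))%E.

Section sensitivity.
Context {R : realType} {T : Type} (d : T -> T -> R) (f : T -> T).

Definition separation_times (x : T) (e delta : R) : set nat :=
  [set n | (1 <= n)%N /\
    exists2 y, d x y < e & d (iter n f x) (iter n f y) > delta].

Definition sensitive : Prop :=
  exists2 delta : R, 0 < delta &
    forall x e, 0 < e -> separation_times x e delta !=set0.

Definition syndetically_sensitive : Prop :=
  exists2 delta : R, 0 < delta &
    forall x e, 0 < e -> syndetic (separation_times x e delta).

Definition ergodically_sensitive : Prop :=
  exists2 delta : R, 0 < delta &
    forall x e, 0 < e -> ergodic R (separation_times x e delta).

End sensitivity.

(* Measurable types are pointed in the library, hence so are the metric spaces
   that carry Borel measures. *)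
#[short(type="pmetricType")]
HB.structure Definition PMetric (R : numDomainType) :=
  {T of Metric R T & isPointed T}.

Section borel_probabilities.
Context {R : realType} (X : pmetricType R).

Definition borel := g_sigma_algebraType (@open X).

HB.instance Definition _ := Measurable.on borel.

Definition borel_probability := probability borel R.

Lemma edist_mdist (x y : X) : edist (x, y) = (mdist x y)%:E.
Proof.
apply/eqP; rewrite eq_le; apply/andP; split.
  apply/lee_addgt0Pr => e e0; rewrite -EFinD; apply: edist_fin => /=.
    by rewrite ltr_wpDl// mdist_ge0.
  by rewrite ballEmdist /= ltrDl.
apply: le_ereal_inf_tmp => _ [r [r0 /=]] + <-.
by rewrite ballEmdist /= lee_fin => /ltW.
Qed.

Definition fattening (A : set X) (e : R) : set X :=
  [set x | (edist_inf A x < e%:E)%E].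

Definition prohorov (mu nu : borel_probability) : R :=
  inf [set e : R | 0 < e /\ forall A : set borel, measurable A ->
    (mu A <= nu (fattening A e) + e%:E)%E /\
    (nu A <= mu (fattening A e) + e%:E)%E].

Lemma continuous_borel_measurable (f : X -> X) :
  continuous f -> measurable_fun [set: borel] (f : borel -> borel).
Proof.
move=> /continuousP cf.
apply: (@measurability _ _ borel borel setT f (@open X)) => //.
move=> _ [A oA <-]; rewrite setTI; apply: sub_sigma_algebra; exact: cf.
Qed.

Definition borel_mfun (f : X -> X) (cf : continuous f) : {mfun borel >-> borel} :=
  HB.pack (f : borel -> borel)
    (isMeasurableFun.Build _ _ borel borel f (continuous_borel_measurable cf)).

(* [distribution mu g A] is [mu (g @^-1` A)]. *)
Definition induced_map (f : X -> X) (cf : continuous f) (mu : borel_probability) :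
  borel_probability := distribution mu (borel_mfun cf).

Lemma induced_mapE (f : X -> X) (cf : continuous f) mu (A : set X) :
  induced_map cf mu A = mu (f @^-1` A).
Proof. by []. Qed.

End borel_probabilities.

(* The order hypothesis provides a base point. *)
Definition compact_itv (R : realType) (a b : R) (ab : a <= b) : Type :=
  set_type (`[a, b]%classic : set R).

Section compact_itv.
Context {R : realType} (a b : R) (ab : a <= b).
Local Notation I := (compact_itv ab).

HB.instance Definition _ := PseudoMetric.copy I (set_type (`[a, b]%classic : set R)).

Let dist (x y : I) : R := `|set_val x - set_val y|.

Let dist_ge0 x y : 0 <= dist x y.
Proof. exact: normr_ge0. Qed.

Let dist_positivity x y : dist x y = 0 -> x = y.
Proof. by move/eqP; rewrite normr_eq0 subr_eq0 => /eqP /val_inj. Qed.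

Let ballEdist x e : ball x e = [set y | dist x y < e].
Proof. by []. Qed.

HB.instance Definition _ :=
  PseudoMetric_isMetric.Build R I dist_ge0 dist_positivity ballEdist.

Let itv_point : I.
Proof. by exists a; rewrite inE /= in_itv /= lexx ab. Defined.

HB.instance Definition _ := isPointed.Build I itv_point.

Lemma mdist_itvE (x y : I) : mdist x y = `|set_val x - set_val y|.
Proof. by []. Qed.

End compact_itv.

(* Main.v *)
(* On an interval, sensitivity is as strong as it can be: the images [f^n J] of a
   nondegenerate interval [J] all have length at least some [eta], independent of
   [J], for [n] large. Indeed, cut the interval into finitely many cells of length
   [delta / 2]; some image of every nondegenerate interval has length at least
   [delta], hence covers a cell. Following cells covered by images of cells, the
   length of [f^n] of a cell is bounded below by the minimum of finitely many
   positive lengths.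

   Given a measure [mu], for large [n] there are two maps [s1], [s2] constant on
   small cells and close to the identity with [f^n \o s1 + eta <= f^n \o s2]. The
   measures [s1_* mu] and [s2_* mu] are close to [mu], and since their images
   under [f^n] are shifted by [eta] from each other they cannot both be close to
   the image of [mu]. So each of the three notions for [f] gives a cofinite set of
   separation times both for [f] and for the induced map. Conversely, sensitivity
   of the induced map at Dirac measures gives that of [f]. *)
Require Import Defs.
From HB Require Import structures.
From mathcomp Require Import all_boot all_order all_algebra finmap.
From mathcomp Require Import all_classical all_reals all_analysis.
From mathcomp Require Import lra zify.

Set Implicit Arguments.
Unset Strict Implicit.
Unset Printing Implicit Defensive.

Import Order.TTheory GRing.Theory Num.Theory.
Import numFieldNormedType.Exports.

Local Open Scope classical_set_scope.
Local Open Scope ring_scope.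

(** * Syndetic and ergodic sets of integers *)

(** Induction on [N] by shifting the set down by one: an enumeration of the shifted set is raised by
    one, with [0] prepended when [0] lies in [A]. *)
Lemma syndetic_cofinite (A : set nat) (N : nat) :
  (forall n, (N <= n)%N -> A n) -> syndetic A.
Proof.
elim: N A => [|N IHN] A AN.
  exists id => //; split.
    by apply/seteqP; split=> n _; [exists n|exact: AN].
  by exists 1%N => // k; lia.
have [n_ ninc [An [l l0 ln]]] : syndetic [set n | A n.+1].
  by apply: IHN => n Nn /=; apply: AN.
have Ak k : A (n_ k).+1.
  by have : range n_ (n_ k) by []; rewrite -An.
have kA n : A n.+1 -> exists k, n_ k = n.
  by move=> An1; have [k _ <-] : range n_ n; [rewrite -An|exists k].
have [A0|A0] := pselect (A 0%N).
  exists (fun k => if k is j.+1 then (n_ j).+1 else 0%N).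
    by move=> [|i] [|j] // ij; rewrite ltnS; exact: ninc.
  split.
    apply/seteqP; split=> [[|n] Ann|_ [[|k] _ <-]] //; first by exists 0%N.
    by have [k <-] := kA _ Ann; exists k.+1.
  exists (maxn l (n_ 0%N).+1) => [|[|k]]; first by rewrite leq_max l0.
    by rewrite subn0 leq_max leqnn orbT.
  by rewrite subSS leq_max ln.
exists (fun k => (n_ k).+1) => [i j /ninc|] //; split; last by exists l.
apply/seteqP; split=> [[|n] // Ann|_ [k _ <-]] //.
by have [k <-] := kA _ Ann; exists k.
Qed.

Lemma syndetic_nonempty (A : set nat) : syndetic A -> A !=set0.
Proof. by case=> n_ _ [-> _]; exists (n_ 0%N); exists 0%N. Qed.

Lemma ergodic_cofinite (R : realType) (A : set nat) (N : nat) :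
  (forall n, (N <= n)%N -> A n) -> ergodic R A.
Proof.
move=> AN; apply: (@lt_le_trans _ _ (2^-1)%:E); first by rewrite lte_fin invr_gt0.
rewrite limn_esup_lim; apply: lime_ge; first exact: is_cvg_esups.
apply: nearW => m.
(* [n] is at least [m], and the integers from [m + N] up to [n], all in [A], make up more than half
   of those below [n]. *)
pose n := ((m + N).*2).+1.
apply: (@le_trans _ _ (#|` fset_set (A `&` `I_n)|%:R / n%:R : R)%:E); last first.
  by apply: ereal_sup_ubound; exists n => //=; rewrite /n; lia.
rewrite lee_fin ler_pdivlMr ?ltr0n// ler_pdivrMl// -natrM ler_nat.
have fA : finite_set (A `&` `I_n) by apply: finite_setIr; exact: finite_II.
have nE : n = (2 * (n - (m + N)) - 1)%N by rewrite /n; lia.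
suff : (n - (m + N) <= #|` fset_set (A `&` `I_n)|)%N by lia.
rewrite -(size_iota (m + N) (n - (m + N))) uniq_leq_size ?iota_uniq// => k.
rewrite mem_iota => /andP[mk kn]; rewrite in_fset_set// inE /=; split; [apply: AN|]; lia.
Qed.

Lemma ergodic_nonempty (R : realType) (A : set nat) : ergodic R A -> A !=set0.
Proof.
rewrite /ergodic => eA; apply/set0P/eqP => A0; move: eA; rewrite A0.
under eq_fun do rewrite set0I fset_set0 cardfs0 mul0r.
have [_ ->] := @cvg_limn_einf_sup _ (cst 0%:E : (\bar R)^nat) 0%E (cvg_cst _).
by rewrite ltxx.
Qed.

Lemma continuous_iter (T : topologicalType) (f : T -> T) n :
  continuous f -> continuous (iter n f).
Proof.
move=> cf; elim: n => [|n IHn] x /=; first exact: cvg_id.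
exact: (continuous_comp (IHn x) (cf _)).
Qed.

(** * The Prohorov metric and induced maps on measures *)

Section prohorov.
Context {R : realType} {X : pmetricType R}.
Implicit Types (mu nu : borel_probability X) (A : set X) (e : R).

Lemma fatteningP A e y : fattening A e y <-> exists2 x, A x & mdist x y < e.
Proof.
split=> [/ereal_inf_lt[_ [x Ax <-]]|[x Ax xy]].
  by rewrite edist_mdist metric_sym lte_fin; exists x.
apply: le_lt_trans (_ : (mdist x y)%:E < _)%E; last by rewrite lte_fin.
by rewrite -edist_mdist edist_sym; apply: ereal_inf_lbound; exists x.
Qed.

Lemma open_borel_measurable A : open A -> measurable (A : set (borel X)).
Proof. exact: sub_sigma_algebra. Qed.

Lemma measurable_continuous_preimage (f : X -> X) A : continuous f ->
  measurable (A : set (borel X)) -> measurable (f @^-1` A : set (borel X)).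
Proof.
move=> cf mA; rewrite -[X in measurable X]setTI.
exact: (continuous_borel_measurable cf).
Qed.

Lemma measurable_fattening A e : measurable (fattening A e : set (borel X)).
Proof.
apply: open_borel_measurable; rewrite openE => y /fatteningP[x Ax xy].
apply/nbhs_ballP; exists (e - mdist x y) => /=; first by rewrite subr_gt0.
move=> z; rewrite ballEmdist /= ltrBrDl => yz; apply/fatteningP; exists x => //.
exact: le_lt_trans (metric_triangle x y z) yz.
Qed.

Lemma prohorov_le mu nu e : 0 < e ->
  (forall A : set (borel X), measurable A ->
    (mu A <= nu (fattening A e) + e%:E)%E /\
    (nu A <= mu (fattening A e) + e%:E)%E) ->
  prohorov mu nu <= e.
Proof. by move=> e0 H; apply: ge_inf => //; exists 0 => r [/ltW]. Qed.

Lemma prohorov_lt mu nu e (A : set (borel X)) : prohorov mu nu < e ->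
  measurable A ->
  (mu A <= nu (fattening A e) + e%:E)%E /\
  (nu A <= mu (fattening A e) + e%:E)%E.
Proof.
move=> /inf_lt[|r [r0 H] re mA].
  (* The infimum runs over a nonempty set: [1] is admissible, as probabilities are at most [1]. *)
  exists 1; split=> // B mB.
  by split; apply: le_trans (probability_le1 _ mB) _; rewrite leeDr.
have sub : fattening A r `<=` fattening A e.
  move=> x /fatteningP[y Ay yx]; apply/fatteningP; exists y => //.
  exact: lt_trans re.
have [H1 H2] := H _ mA; split.
  apply: (le_trans H1); apply: leeD; last by rewrite lee_fin ltW.
  by apply: le_measure; rewrite ?inE //; exact: measurable_fattening.
apply: (le_trans H2); apply: leeD; last by rewrite lee_fin ltW.
by apply: le_measure; rewrite ?inE //; exact: measurable_fattening.
Qed.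

Lemma iter_induced_mapE (f : X -> X) (cf : continuous f) n mu A :
  iter n (induced_map cf) mu A = mu (iter n f @^-1` A).
Proof. by elim: n A => //= n IHn A; rewrite induced_mapE IHn. Qed.

(* A measure close to the Dirac measure at [x] has most of its mass near [x], so
   its images stay close to those of the Dirac measure as long as the images of a
   ball around [x] stay small. *)
Lemma separation_times_dirac (f : X -> X) (cf : continuous f) (x : X) e delta :
  0 < e -> e <= delta ->
  separation_times (@prohorov R X) (induced_map cf)
    (dirac (x : borel X)) e delta `<=`
  separation_times (@mdist R X) f x e (delta / 2).
Proof.
move=> e0 ed n [n1 [nu xnu nnu]]; split=> //; apply: contrapT => small.
have {}small y : mdist x y < e ->
    mdist (iter n f x) (iter n f y) <= delta / 2.
  by move=> xy; rewrite leNgt; apply/negP => yd; apply: small; exists y.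
have mf := measurable_continuous_preimage (@continuous_iter _ _ n cf).
have xX : measurable ([set x] : set (borel X)).
  rewrite -[X in measurable X]setCK; apply: measurableC.
  apply: open_borel_measurable; apply: closed_openC.
  apply: accessible_closed_set1; apply: hausdorff_accessible.
  exact: metric_hausdorff.
have dE (A : set (borel X)) :
    (dirac (x : borel X) : borel_probability X) A = (x \in A)%:R%:E.
  exact: diracE.
have [+ _] := prohorov_lt xnu xX.
rewrite dE mem_set //= => nuB.
have d0 : 0 < delta by exact: lt_le_trans ed.
(* Halving [delta] leaves room for the strict inequality that fattenings demand. *)
have {small} ballf y : fattening [set x] e y ->
    mdist (iter n f x) (iter n f y) < delta.
  move=> /fatteningP[_ -> /small /le_lt_trans]; apply; lra.
move: nnu; apply/negP; rewrite -leNgt; apply: prohorov_le => // A mA.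
rewrite !iter_induced_mapE !dE; split.
  have [|_] := boolP (x \in _); last by rewrite adde_ge0 ?measure_ge0 ?lee_fin ?ltW.
  rewrite inE => Ax; apply: (le_trans nuB); apply: leeD; last by rewrite lee_fin.
  apply: le_measure; rewrite ?inE; first exact: measurable_fattening.
    by apply: mf; exact: measurable_fattening.
  by move=> y /ballf xy; apply/fatteningP; exists (iter n f x).
have [_|] := boolP (x \in _).
  by apply: le_trans (probability_le1 _ (mf _ mA)) _; rewrite leeDl ?lee_fin ?ltW.
rewrite notin_setE => Ax; rewrite add0e.
(* Here [A] lies at distance at least [delta] from the image of [x], so its preimage misses the
   [e]-ball around [x], whose complement has [nu]-mass at most [e]. *)
apply: (@le_trans _ _ (nu (~` fattening [set x] e))).
  apply: le_measure; rewrite ?inE; first exact: mf.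
    by apply: measurableC; exact: measurable_fattening.
  move=> y Ay /ballf xy; apply: Ax; apply/fatteningP.
  by exists (iter n f y); rewrite // metric_sym.
rewrite probability_setC; last exact: measurable_fattening.
rewrite leeBlDr ?fin_num_measure//; last exact: measurable_fattening.
by rewrite addeC; apply: (le_trans nuB); rewrite leeD2l ?lee_fin.
Qed.

Lemma sensitive_induced_map (f : X -> X) (cf : continuous f) :
  sensitive (@prohorov R X) (induced_map cf) -> sensitive (@mdist R X) f.
Proof.
move=> [delta d0 H]; exists (delta / 2) => [|x e e0]; first by rewrite divr_gt0.
(* The comparison at Dirac measures requires a radius at most [delta]. *)
have m0 : 0 < Num.min e delta by rewrite lt_min e0.
have [n] := H (dirac (x : borel X)) _ m0.
move/separation_times_dirac => /(_ m0); rewrite ge_min lexx orbT.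
move=> /(_ isT)[n1 [y xy yd]].
by exists n; split=> //; exists y => //; apply: lt_le_trans xy _; rewrite ge_min lexx.
Qed.

End prohorov.

(** * Growth of intervals under a continuous real map *)

Section interval_dynamics.
Context {R : realType} (a b : R) (F : R -> R).
Hypothesis Fcont : continuous F.
Hypothesis Fab : forall t, a <= F t <= b.

(** A lower bound on the oscillation of [g], given by witnesses whose order on the line is left
    free. *)
Definition spread_ge (g : R -> R) (u v c : R) :=
  exists y z, [/\ u <= y <= v, u <= z <= v & g y + c <= g z].

Lemma spread_geW g u v c c' : c' <= c -> spread_ge g u v c -> spread_ge g u v c'.
Proof.
by move=> cc' [y [z [yuv zuv yz]]]; exists y, z;
  split=> //; apply: le_trans yz; rewrite lerD2l.
Qed.

Lemma iter_in_itv n t : (0 < n)%N -> a <= iter n F t <= b.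
Proof. by case: n => // n _; exact: Fab. Qed.

Lemma IVT_spread (g : R -> R) u v c : continuous g -> spread_ge g u v c ->
  exists y, [/\ u <= y <= v, exists2 z, u <= z <= v & g y + c <= g z &
    forall w, g y <= w <= g y + c -> exists2 t, u <= t <= v & g t = w].
Proof.
move=> cg [y [z [yuv zuv yz]]]; exists y; split=> //; first by exists z.
move=> w /andP[yw wc].
have ivt s t : u <= s -> s <= t -> t <= v ->
    Num.min (g s) (g t) <= w <= Num.max (g s) (g t) ->
    exists2 t, u <= t <= v & g t = w.
  move=> us st tv /(IVT st (continuous_subspaceT cg))[r].
  rewrite in_itv /= => /andP[sr rt] <-.
  by exists r; rewrite // (le_trans us) ?(le_trans rt).
have /andP[uy yv] := yuv; have /andP[uz zv] := zuv.
have wz : w <= g z by exact: le_trans yz.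
have [yz'|zy] := leP y z.
  by apply: (ivt y z) => //; rewrite ge_min yw le_max wz orbT.
by apply: (ivt z y) (ltW zy) _ _ => //; rewrite ge_min yw le_max wz !orbT.
Qed.

Variable delta : R.
Hypothesis delta0 : 0 < delta.
Hypothesis Fsens : forall u v, a <= u -> u < v -> v <= b ->
  exists2 n, (0 < n)%N & spread_ge (iter n F) u v delta.

Let h := delta / 2.
Let cell i := a + i%:R * h.
Let valid i := cell i.+1 <= b.

Let h0 : 0 < h. Proof. by rewrite divr_gt0. Qed.

Let cellS i : cell i.+1 = cell i + h.
Proof. by rewrite /cell -addn1 natrD; lra. Qed.

Let ge_cell i : a <= cell i.
Proof. by rewrite lerDl mulr_ge0// ltW. Qed.

Let cell_lt i : cell i < cell i.+1.
Proof. by rewrite cellS ltrDl. Qed.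

Let covers n u v i :=
  forall w, cell i <= w <= cell i.+1 -> exists2 t, u <= t <= v & iter n F t = w.

Let covers_spread n u v i k c : covers n u v i ->
  spread_ge (iter k F) (cell i) (cell i.+1) c ->
  spread_ge (iter (k + n) F) u v c.
Proof.
move=> cov [_ [_ [/cov[y yuv <-] /cov[z zuv <-] yz]]].
by exists y, z; rewrite !iterD.
Qed.

Let covers_cell u v : a <= u -> u < v -> v <= b ->
  exists n i, [/\ (0 < n)%N, valid i & covers n u v i].
Proof.
move=> au uv vb; have [n n0] := Fsens au uv vb.
move=> /(IVT_spread (@continuous_iter _ _ n Fcont))[y [yuv [z zuv yz] cov]].
have /andP[ay yb] := iter_in_itv y n0; have /andP[az zb] := iter_in_itv z n0.
have q0 : 0 <= (iter n F y - a) / h by rewrite divr_ge0 ?subr_ge0// ltW.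
(* Cell [i] holds the lower value; the next cell, of length [delta / 2], then fits in the band of
   height [delta] above that value. *)
pose i := Num.truncn ((iter n F y - a) / h).
have /andP[] := truncn_itv q0; rewrite -/i ler_pdivlMr// ltr_pdivrMr// => iy yi.
have yc : iter n F y <= cell i.+1 by rewrite /cell; lra.
have cd : cell i.+2 <= iter n F y + delta.
  rewrite !cellS /cell /h in iy *; lra.
exists n, i.+1; split=> //.
  by rewrite /valid; apply: le_trans zb; exact: le_trans yz.
by move=> w /andP[cw wc]; apply: cov; rewrite (le_trans yc)// (le_trans wc).
Qed.

(** If the [r]-th iterate were constant on the interval, so would be all later ones; the finitely
    many earlier ones vary by less than [delta] on a short piece starting at [u]. No iterate would
    then spread that piece by [delta]. *)
Let iter_nonconstant r u v : a <= u -> u < v -> v <= b ->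
  exists2 c, 0 < c & spread_ge (iter r F) u v c.
Proof.
move=> au uv vb; apply: contrapT => const.
have {}const y z : u <= y <= v -> u <= z <= v -> iter r F y <= iter r F z.
  move=> yuv zuv; rewrite leNgt; apply/negP => zy; apply: const.
  exists (iter r F y - iter r F z); first by rewrite subr_gt0.
  by exists z, y; rewrite addrC subrK.
have {}const n y z : (r <= n)%N -> u <= y <= v -> u <= z <= v ->
    iter n F y = iter n F z.
  move=> /subnK <- yuv zuv; rewrite !iterD; congr iter.
  by apply/le_anti; rewrite !const.
have : \forall y \near u, forall n : 'I_r, `|iter n F u - iter n F y| < h.
  apply: (@filter_forall R 'I_r (fun n y => `|iter n F u - iter n F y| < h)
    (nbhs u) _) => n.
  by have /cvgr_dist_lt := @continuous_iter _ _ n Fcont u; apply.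
move=> /nbhs_ballP[e /= e0 ue].
have [||n n0] := @Fsens u (Num.min v (u + e / 2)) au.
- by rewrite lt_min uv /= ltrDl divr_gt0.
- by rewrite ge_min vb.
move=> [y [z [/andP[uy] + /andP[uz]]]]; rewrite !le_min.
move=> /andP[yv ye] /andP[zv ze] yz.
have [nr|rn] := ltnP n r; last first.
  by by move: yz; rewrite (const n y z) ?uy ?uz// gerDl leNgt delta0.
have near_u w : u <= w -> w <= u + e / 2 -> `|iter n F u - iter n F w| < h.
  move=> uw we; apply: (ue w _ (Ordinal nr)).
  by rewrite /ball /= ltr_distlC; lra.
have := near_u _ uy ye; have := near_u _ uz ze.
rewrite !ltr_distlC /h => /andP[? ?] /andP[? ?]; lra.
Qed.

Lemma eventual_spread : exists2 eta, 0 < eta & forall u v,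
  a <= u -> u < v -> v <= b ->
  exists N, forall n, (N <= n)%N -> spread_ge (iter n F) u v eta.
Proof.
(* [p i] records a time and a cell covered by the image of cell [i] at that time; [(0, 0)] is a
   dummy for cells outside the interval. *)
have /choice[p pP] i : exists p : nat * nat, valid i ->
    [/\ (0 < p.1)%N, valid p.2 & covers p.1 (cell i) (cell i.+1) p.2].
  have [vi|] := pselect (valid i); last by exists (0%N, 0%N).
  have [n [j H]] := covers_cell (ge_cell i) (cell_lt i) vi.
  by exists (n, j).
pose m := (Num.truncn ((b - a) / h)).+1.
have valid_lt i : valid i -> (i < m)%N.
  rewrite /valid /cell => vi; rewrite -(ltr_nat R).
  apply: le_lt_trans (_ : (b - a) / h < _); last exact: truncnS_gt.
  rewrite ler_pdivlMr//.
  by move: vi; rewrite -addn1 natrD => ?; have := h0 => ?; lra.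
pose M := \max_(i < m) (p i).1.
(* One bound serves finitely many cells and all times up to [M], the longest transition. *)
have [eta eta0 etaP] : exists2 eta, 0 < eta & forall i r, valid i -> (r <= M)%N ->
    spread_ge (iter r F) (cell i) (cell i.+1) eta.
  have : \forall eta \near 0^'+, forall ir : 'I_m * 'I_M.+1, valid ir.1 ->
      spread_ge (iter ir.2 F) (cell ir.1) (cell ir.1.+1) eta.
    apply: (@filter_forall R _ (fun (ir : 'I_m * 'I_M.+1) eta => valid ir.1 ->
      spread_ge (iter ir.2 F) (cell ir.1) (cell ir.1.+1) eta) 0^'+ _) => -[i r] /=.
    have [vi|] := pselect (valid i); last by move=> ?; near=> x.
    have [c c0 cP] := iter_nonconstant r (ge_cell i) (cell_lt i) vi.
    near=> eta => _; apply: spread_geW cP; near: eta; exact: nbhs_right_le.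
  move=> H; near (0 : R)^'+ => eta; exists eta => // i r vi rM.
  rewrite -[r](@inordK M)//.
  suff /(_ (Ordinal (valid_lt _ vi), inord r)) : forall ir : 'I_m * 'I_M.+1,
    valid ir.1 -> spread_ge (iter ir.2 F) (cell ir.1) (cell ir.1.+1) eta by exact.
  by near: eta.
exists eta => // u v au uv vb.
have {}etaP n : forall i, valid i -> spread_ge (iter n F) (cell i) (cell i.+1) eta.
  (* Past [M], cell [i] first covers cell [(p i).2]; the time [(p i).1] spent is positive, so the
     induction hypothesis handles the rest. *)
  elim/ltn_ind: n => n IHn i vi; have [nM|Mn] := leqP n M; first exact: etaP.
  have [p0 vp cov] := pP i vi.
  have pn : ((p i).1 <= n)%N.
    apply: leq_trans (ltnW Mn).
    exact: (leq_bigmax (Ordinal (valid_lt _ vi))).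
  rewrite -(subnK pn); apply: covers_spread cov _; apply: IHn => //; lia.
have [N [i [_ vi cov]]] := covers_cell au uv vb.
exists N => n Nn; rewrite -(subnK Nn); apply: covers_spread cov _; exact: etaP.
Unshelve. all: by end_near. Qed.

End interval_dynamics.

(** * Measures pushed forward by step maps *)

Section induced_step_maps.
Context {R : realType} {X : pmetricType R}.

Lemma measurable_preimage (s : {mfun borel X >-> borel X}) (A : set (borel X)) :
  measurable A -> measurable (s @^-1` A).
Proof. by move=> mA; rewrite -[X in measurable X]setTI; exact: measurable_funP. Qed.

(** Points of [A] are sent by [s] into its fattening, and points sent into [A] already lie in its
    fattening. *)
Lemma prohorov_distribution (mu : borel_probability X)
    (s : {mfun borel X >-> borel X}) e :
  (forall x, mdist x (s x) < e) -> prohorov mu (distribution mu s) <= e.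
Proof.
move=> se; have e0 : 0 < e by apply: le_lt_trans (se point); exact: mdist_ge0.
apply: prohorov_le => // A mA; split.
  apply: (@le_trans _ _ (mu (s @^-1` fattening A e))); last first.
    by rewrite leeDl// lee_fin ltW.
  apply: le_measure; rewrite ?inE//.
    by apply: measurable_preimage; exact: measurable_fattening.
  by move=> x Ax; apply/fatteningP; exists x.
apply: (@le_trans _ _ (mu (fattening A e))); last by rewrite leeDl// lee_fin ltW.
apply: (@le_measure _ _ _ mu (s @^-1` A)); rewrite ?inE//.
- exact: measurable_preimage.
- exact: measurable_fattening.
- by move=> x Ax; apply/fatteningP; exists (s x); rewrite // metric_sym.
Qed.

Lemma measurable_step (idx : X -> nat) (G : nat -> X) :
  (forall k, measurable (idx @^-1` [set k] : set (borel X))) ->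
  measurable_fun [set: borel X] (G \o idx : borel X -> borel X).
Proof.
move=> midx _ A mA; rewrite setTI.
have -> : (G \o idx) @^-1` A = \bigcup_(k in G @^-1` A) idx @^-1` [set k].
  by apply/seteqP; split=> [x Ax|x [k Ak /= xk]]; [exists (idx x)|rewrite xk].
exact: bigcup_measurable.
Qed.

Definition step_mfun (idx : X -> nat) (G : nat -> X)
    (midx : forall k, measurable (idx @^-1` [set k] : set (borel X))) :
  {mfun borel X >-> borel X} :=
  HB.pack (G \o idx : borel X -> borel X)
    (isMeasurableFun.Build _ _ (borel X) (borel X) _ (measurable_step G midx)).

End induced_step_maps.

(** * Interval maps and their extension to the real line *)

Section itv.
Context {R : realType} (a b : R) (ab : a <= b).
Local Notation I := (compact_itv ab).
Implicit Types (x y : I) (t : R).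

Lemma set_val_itv x : a <= set_val x <= b.
Proof. by have := set_valP x; rewrite /= in_itv. Qed.

Let clamp_itv t : Num.max a (Num.min b t) \in (`[a, b]%classic : set R).
Proof. by rewrite inE /= in_itv /= le_max lexx ge_max ab ge_min lexx. Qed.

(** The nearest-point retraction, through which a map of the interval extends to a continuous real
    map. *)
Definition clamp t : I :=
  exist (fun s => s \in (`[a, b]%classic : set R)) _ (clamp_itv t).

Let set_val_clamp t : set_val (clamp t) = Num.max a (Num.min b t).
Proof. by []. Qed.

Lemma clampE t : a <= t <= b -> set_val (clamp t) = t.
Proof. by move=> /andP[at_ tb]; rewrite set_val_clamp min_r// max_r. Qed.

Lemma clamp_set_val x : clamp (set_val x) = x.
Proof. by apply: val_inj; rewrite /= [LHS](clampE (set_val_itv x)). Qed.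

Lemma continuous_set_val : continuous (set_val : I -> R).
Proof. exact: initial_continuous. Qed.

(** Clamping is 1-Lipschitz. *)
Lemma continuous_clamp : continuous clamp.
Proof.
move=> t; apply/cvg_ballP => e e0; apply/nbhs_ballP; exists e => //= s.
rewrite /ball /= => ts.
change (`|set_val (clamp t) - set_val (clamp s)| < e); rewrite !set_val_clamp.
move: ts; rewrite !ltr_distl => /andP[? ?].
by case: (leP b t) => ?; case: (leP b s) => ?; rewrite ?(max_r ab);
  try case: (leP a t) => ?; try case: (leP a s) => ?; have := ab => ?; lra.
Qed.

Section interval_map.
Variable f : I -> I.
Hypothesis cf : continuous f.

Let F t : R := set_val (f (clamp t)).

Let iterF n x : iter n F (set_val x) = set_val (iter n f x).
Proof. by elim: n => //= n ->; rewrite /F clamp_set_val. Qed.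

Let iterFc n t : a <= t <= b -> iter n F t = set_val (iter n f (clamp t)).
Proof. by move=> tab; rewrite -iterF clampE. Qed.

Let Fcont : continuous F.
Proof.
move=> t; apply: (@continuous_comp _ _ _ clamp (set_val \o f)).
  exact: continuous_clamp.
apply: continuous_comp; first exact: cf.
exact: continuous_set_val.
Qed.

Lemma sensitive_lt : sensitive (@mdist R I) f -> a < b.
Proof.
move=> [delta d0 /(_ point 1 ltr01)[n [_ [y _]]]].
rewrite mdist_itvE; have := set_val_itv (iter n f y).
have := set_val_itv (iter n f point).
move=> /andP[? ?] /andP[? ?]; rewrite lter_normr => /orP yd.
by rewrite ltNge; apply/negP => ?; case: yd => ?; lra.
Qed.

Lemma sensitive_eventual_spread : sensitive (@mdist R I) f ->
  exists2 eta, 0 < eta & forall u v, a <= u -> u < v -> v <= b ->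
  exists N, forall n, (N <= n)%N -> spread_ge (iter n F) u v eta.
Proof.
move=> [delta d0 fsens].
apply: (@eventual_spread _ a b F Fcont _ delta d0) => [t|u v au uv vb].
  exact: set_val_itv.
(* Sensitivity at the midpoint, with half the length as radius, yields a separating point inside the
   interval. *)
have e0 : 0 < (v - u) / 2 by lra.
have mab : a <= (u + v) / 2 <= b by lra.
have [n [n1 [y]]] := fsens (clamp ((u + v) / 2)) _ e0.
rewrite !mdist_itvE -!iterF clampE// => + yd.
rewrite ltr_distl => /andP[yu yv]; exists n => //.
have [le|/ltW le] := leP (iter n F ((u + v) / 2)) (iter n F (set_val y)).
  exists ((u + v) / 2), (set_val y); split; [lra|lra|].
  move: yd; rewrite distrC ger0_norm ?subr_ge0// => ?; lra.
exists (set_val y), ((u + v) / 2); split; [lra|lra|].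
move: yd; rewrite ger0_norm ?subr_ge0// => ?; lra.
Qed.

Lemma sensitive_cofinite : sensitive (@mdist R I) f ->
  exists2 delta, 0 < delta & forall x e, 0 < e -> exists N, forall n,
    (N <= n)%N -> separation_times (@mdist R I) f x e delta n.
Proof.
move=> fsens; have ab' := sensitive_lt fsens.
have [eta eta0 H] := sensitive_eventual_spread fsens.
(* Two images [eta] apart cannot both be within [eta / 3] of the image of [x]. *)
exists (eta / 3) => [|x e e0]; first by rewrite divr_gt0.
pose u := Num.max a (set_val x - e / 2); pose v := Num.min b (set_val x + e / 2).
have /andP[ax xb] := set_val_itv x.
have [||| N HN] := H u v.
- by rewrite /u le_max lexx.
- rewrite /u /v gt_max !lt_min ab' /=; apply/and3P; split; lra.
- by rewrite /v ge_min lexx.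
exists (maxn 1 N) => n; rewrite geq_max => /andP[n1 /HN[y [z [yuv zuv yz]]]].
split=> //.
have inI w : u <= w <= v -> a <= w <= b /\ `|set_val x - w| < e.
  rewrite /u /v ge_max le_min ltr_distl => /andP[/andP[? ?] /andP[? ?]].
  by split; lra.
have [[yab xy] [zab xz]] := (inI _ yuv, inI _ zuv).
have [yn|yn] := leP `|iter n F (set_val x) - iter n F y| (eta / 3); last first.
  by exists (clamp y); rewrite mdist_itvE ?clampE// -iterF -iterFc.
exists (clamp z); rewrite mdist_itvE ?clampE// -iterF -iterFc//.
rewrite ltNge; apply/negP; move: yn; rewrite !ler_distl => /andP[? ?] /andP[? ?].
lra.
Qed.

(** * Tails of measures and separation for the induced map *)

Definition tail (mu : borel_probability I) t := mu [set x : I | t <= set_val x].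

Let measurable_tail t : measurable ([set x : I | t <= set_val x] : set (borel I)).
Proof.
have -> : [set x : I | t <= set_val x] = ~` (set_val @^-1` [set s | s < t]).
  by apply/seteqP; split=> x /=; rewrite leNgt => /negP.
apply: measurableC; apply: open_borel_measurable.
by move/continuousP : continuous_set_val; apply; exact: open_lt.
Qed.

Let le_tail mu s t : s <= t -> (tail mu t <= tail mu s)%E.
Proof.
move=> st; apply: le_measure; rewrite ?inE; [exact: measurable_tail..|].
by move=> x /=; exact: le_trans.
Qed.

(** The [e]-fattening of a right ray lies in the ray that starts [e] earlier. *)
Lemma tail_prohorov mu nu e t : prohorov mu nu < e ->
  (tail mu t <= tail nu (t - e) + e%:E)%E /\
  (tail nu t <= tail mu (t - e) + e%:E)%E.
Proof.
have sub : fattening [set x : I | t <= set_val x] e `<=`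
    [set x : I | t - e <= set_val x].
  move=> y /fatteningP[x /= tx]; rewrite mdist_itvE ltr_distl => /andP[? ?]; lra.
move=> /prohorov_lt /(_ (measurable_tail t))[H1 H2]; split.
  apply: (le_trans H1); rewrite leeD2r//.
  by apply: le_measure; rewrite ?inE//; exact: measurable_fattening.
apply: (le_trans H2); rewrite leeD2r//.
by apply: le_measure; rewrite ?inE//; exact: measurable_fattening.
Qed.

(* If [nu2] is [nu1] pushed to the right by [eta], no measure is close to both:
   the tails of [nu1] would be almost constant over [[a, b]]. *)
Lemma prohorov_shift (eta : R) : 0 < eta ->
  exists2 delta, 0 < delta & forall mu nu1 nu2 : borel_probability I,
    (forall t, (tail nu1 t <= tail nu2 (t + eta))%E) ->
    delta < prohorov mu nu1 \/ delta < prohorov mu nu2.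
Proof.
move=> eta0; pose K := (Num.truncn ((b - a) / (eta / 2))).+1.
have K0 : 0 < K%:R :> R by rewrite ltr0n.
(* [eta / 4] lets two passages through [mu] lose at most half of the shift; the other bound keeps
   the total error of [K] steps, [K * (2 * d)], at most [1 / 2]. *)
pose d : R := Num.min (eta / 4) (4 * K%:R)^-1.
have d0 : 0 < d by rewrite lt_min divr_gt0//= invr_gt0 mulr_gt0.
exists (d / 2) => [|mu nu1 nu2 shift]; first by rewrite divr_gt0.
have [|c1] := ltP (d / 2) (prohorov mu nu1); first by left.
have [|c2] := ltP (d / 2) (prohorov mu nu2); first by right.
exfalso.
have {}c1 : prohorov mu nu1 < d by apply: le_lt_trans c1 _; lra.
have {}c2 : prohorov mu nu2 < d by apply: le_lt_trans c2 _; lra.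
have step t : (tail nu1 t <= tail nu1 (t + eta / 2) + (2 * d)%:E)%E.
  apply: (le_trans (shift t)).
  have [_ /le_trans] := tail_prohorov (t + eta) c2; apply.
  have [H _] := tail_prohorov (t + eta - d) c1.
  apply: (@le_trans _ _ (tail nu1 (t + eta - d - d) + d%:E + d%:E)%E).
    by rewrite leeD2r.
  rewrite -addeA -EFinD -mulr2n -[d *+ 2]mulr_natl leeD2r// le_tail//.
  have : d <= eta / 4 by rewrite ge_min lexx.
  by move=> ?; lra.
have steps k : (tail nu1 a <= tail nu1 (a + k%:R * (eta / 2)) + (k%:R * (2 * d))%:E)%E.
  elim: k => [|k IHk]; first by rewrite !mul0r !addr0.
  have -> : a + k.+1%:R * (eta / 2) = a + k%:R * (eta / 2) + eta / 2.
    by rewrite -addn1 natrD; lra.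
  have -> : k.+1%:R * (2 * d) = 2 * d + k%:R * (2 * d).
    by rewrite -addn1 natrD; lra.
  by apply: (le_trans IHk); rewrite EFinD addeA leeD2r.
(* [K] steps of [eta / 2] lead from [a] past [b], where the tail drops from [1] to [0]. *)
have := steps K; apply/negP; rewrite -ltNge.
have -> : tail nu1 a = 1%E.
  rewrite -(probability_setT nu1); congr (nu1 _); apply/seteqP; split=> // x _.
  by have /andP[] := set_val_itv x.
have -> : tail nu1 (a + K%:R * (eta / 2)) = 0%E.
  rewrite -(measure0 nu1); congr (nu1 _); apply/seteqP; split=> // x /=.
  have := truncnS_gt ((b - a) / (eta / 2)); rewrite -/K.
  rewrite ltr_pdivrMr ?divr_gt0// => KK.
  have /andP[_ xb] := set_val_itv x; lra.
rewrite add0e lte_fin.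
have : d <= (4 * K%:R)^-1 by rewrite ge_min lexx orbT.
rewrite -[X in _ <= X]mul1r ler_pdivlMr ?mulr_gt0// => ?; lra.
Qed.

Lemma sensitive_induced_cofinite : sensitive (@mdist R I) f ->
  exists2 delta, 0 < delta & forall mu e, 0 < e -> exists N, forall n,
    (N <= n)%N -> separation_times (@prohorov R I) (induced_map cf) mu e delta n.
Proof.
move=> fsens; have ab' := sensitive_lt fsens.
have [eta eta0 H] := sensitive_eventual_spread fsens.
have [delta d0 shift] := prohorov_shift eta0; exists delta => // mu e e0.
(* [e / 3] keeps each cell shorter than [e / 2]; [b - a] keeps [b - h] inside the interval. *)
pose h := Num.min (e / 3) (b - a).
have h0 : 0 < h by rewrite lt_min subr_gt0 ab' divr_gt0.
have he : h <= e / 3 by rewrite ge_min lexx.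
have hab : h <= b - a by rewrite ge_min lexx orbT.
pose idx (x : I) := Num.truncn ((set_val x - a) / h).
have q0 (x : I) : 0 <= (set_val x - a) / h.
  by rewrite divr_ge0 ?(ltW h0)// subr_ge0; have /andP[] := set_val_itv x.
have idxE x k : (idx x == k) = (a + k%:R * h <= set_val x < a + k.+1%:R * h).
  by rewrite truncn_eq// ler_pdivlMr// ltr_pdivrMr// lerBrDl ltrBlDl.
have midx k : measurable (idx @^-1` [set k] : set (borel I)).
  rewrite (_ : _ @^-1` _ = [set x | a + k%:R * h <= set_val x] `\`
      [set x | a + k.+1%:R * h <= set_val x]); first exact: measurableD.
  apply/seteqP; split=> x /=.
    by move=> /eqP; rewrite idxE ltNge => /andP[? /negP].
  by move=> [xk /negP]; rewrite -ltNge => kx; apply/eqP; rewrite idxE xk.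
(* Truncating at [b - h] keeps the interval attached to the last cell
   nondegenerate. *)
pose u k := Num.min (a + k%:R * h) (b - h).
have kh0 k : 0 <= k%:R * h by rewrite mulr_ge0// ltW.
have au k : a <= u k by rewrite le_min lerDl kh0 /=; lra.
have ub k : u k + h <= b.
  by have : u k <= b - h by [rewrite ge_min lexx orbT]; move=> ?; lra.
(* When the truncation is active, [x] lies within [h] of [b]. *)
have uidx x : u (idx x) <= set_val x <= u (idx x) + h.
  have /andP[ax xb] := set_val_itv x.
  have := eqxx (idx x); rewrite idxE -addn1 natrD => /andP[xk kx].
  by rewrite /u; case: (leP (a + _)) => ?; apply/andP; split; lra.
pose m := (Num.truncn ((b - a) / h)).+1.
have idxm x : (idx x < m)%N.
  rewrite ltnS; apply: le_truncn; rewrite ler_pM2r ?invr_gt0// lerB//.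
  by have /andP[] := set_val_itv x.
have /choice[N HN] k : exists N, forall n, (N <= n)%N ->
    spread_ge (iter n F) (u k) (u k + h) eta.
  by apply: H => //; rewrite ltrDl.
exists (maxn 1 (\max_(k < m) N k)) => n; rewrite geq_max => /andP[n1 Nn].
have /choice[p pP] k : exists p : R * R, (k < m)%N -> [/\ u k <= p.1 <= u k + h,
    u k <= p.2 <= u k + h & iter n F p.1 + eta <= iter n F p.2].
  have [km|_] := ltnP k m; last by exists (0, 0).
  have [|y [z yz]] := HN k n; last by exists (y, z).
  exact: leq_trans (leq_bigmax (Ordinal km)) Nn.
have cell_close x w : u (idx x) <= w <= u (idx x) + h ->
    a <= w <= b /\ `|set_val x - w| < e / 2.
  have := au (idx x); have := ub (idx x); move: (uidx x) => /andP[? ?] ? ? /andP[? ?].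
  by rewrite ltr_distl; split; lra.
(* On each cell, [s1] picks the point with low image and [s2] the one with high image. *)
pose s1 := step_mfun (fun k => clamp (p k).1) midx.
pose s2 := step_mfun (fun k => clamp (p k).2) midx.
have s12 x : [/\ mdist x (s1 x) < e / 2, mdist x (s2 x) < e / 2 &
    set_val (iter n f (s1 x)) + eta <= set_val (iter n f (s2 x))].
  have [/cell_close[y_itv xy] /cell_close[z_itv xz] yz] := pP _ (idxm x).
  have -> : s1 x = clamp (p (idx x)).1 by [].
  have -> : s2 x = clamp (p (idx x)).2 by [].
  by rewrite !mdist_itvE !clampE// -!iterFc.
have near_mu (s : {mfun borel I >-> borel I}) :
    (forall x, mdist x (s x) < e / 2) -> prohorov mu (distribution mu s) < e.
  by move=> /(prohorov_distribution mu) /le_lt_trans; apply; lra.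
have mf := measurable_continuous_preimage (@continuous_iter _ _ n cf).
(* The two perturbed images are shifted by [eta], so one of them is more than [delta] away from the
   image of [mu]. *)
have [|d1|d2] := shift (iter n (induced_map cf) mu)
  (iter n (induced_map cf) (distribution mu s1))
  (iter n (induced_map cf) (distribution mu s2)).
- move=> t; rewrite /tail !iter_induced_mapE.
  apply: (@le_measure _ _ _ mu (s1 @^-1` _) (s2 @^-1` _)); rewrite ?inE.
  + by apply: measurable_preimage; apply: mf; exact: measurable_tail.
  + by apply: measurable_preimage; apply: mf; exact: measurable_tail.
  + move=> x /= tx; have [_ _] := s12 x; apply: le_trans; by rewrite lerD2r.
- split=> //; exists (distribution mu s1) => //.
  by apply: near_mu => x; have [] := s12 x.
- split=> //; exists (distribution mu s2) => //.
  by apply: near_mu => x; have [] := s12 x.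
Qed.

End interval_map.
End itv.

(** * Passing between the three notions *)

Lemma syndetically_sensitive_sensitive (R : realType) (T : Type)
    (d : T -> T -> R) (f : T -> T) :
  syndetically_sensitive d f -> sensitive d f.
Proof.
by move=> [delta d0 H]; exists delta => // x e /(H x) /syndetic_nonempty.
Qed.

Lemma ergodically_sensitive_sensitive (R : realType) (T : Type)
    (d : T -> T -> R) (f : T -> T) :
  ergodically_sensitive d f -> sensitive d f.
Proof.
by move=> [delta d0 H]; exists delta => // x e /(H x) /ergodic_nonempty.
Qed.

Lemma cofinitely_sensitive (R : realType) (T : Type)
    (d : T -> T -> R) (f : T -> T) :
  (exists2 delta, 0 < delta & forall x e, 0 < e -> exists N, forall n,
    (N <= n)%N -> separation_times d f x e delta n) ->
  [/\ sensitive d f, syndetically_sensitive d f & ergodically_sensitive d f].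
Proof.
move=> [delta d0 H]; split; exists delta => // x e /(H x)[N NP].
- by exists N; exact: NP.
- exact: syndetic_cofinite NP.
- exact: ergodic_cofinite NP.
Qed.

Theorem theorem4p5 (R : realType) (a b : R) (ab : (a <= b)%R)
    (f : compact_itv ab -> compact_itv ab) (cf : continuous f) :
  (sensitive (@mdist R (compact_itv ab)) f <->
     sensitive (@prohorov R (compact_itv ab)) (induced_map cf)) /\
  (syndetically_sensitive (@mdist R (compact_itv ab)) f <->
     syndetically_sensitive (@prohorov R (compact_itv ab)) (induced_map cf)) /\
  (ergodically_sensitive (@mdist R (compact_itv ab)) f <->
     ergodically_sensitive (@prohorov R (compact_itv ab)) (induced_map cf)).
Proof.
have down : sensitive (@prohorov R (compact_itv ab)) (induced_map cf) ->
    sensitive (@mdist R (compact_itv ab)) f by exact: sensitive_induced_map.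
have base fs := cofinitely_sensitive (sensitive_cofinite cf fs).
have up fs := cofinitely_sensitive (sensitive_induced_cofinite cf fs).
(* Each stronger notion is weakened to plain sensitivity, which reaches [f], and recovered from
   cofinite separation times. *)
split; last split; split.
- by move=> /up[].
- exact: down.
- by move=> /syndetically_sensitive_sensitive/up[].
- by move=> /syndetically_sensitive_sensitive/down/base[].
- by move=> /ergodically_sensitive_sensitive/up[].
- by move=> /ergodically_sensitive_sensitive/down/base[].
Qed.
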